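(* There exist an absolute constant $C_1>0$ and, for each $D\ge1$, constants $C_2=C_2(D)$ and $\delta_*=\delta_*(D)>0$, and for each $(D,K,\sigma_{\max})$ a constant $C_3=C_3(D,K,\sigma_{\max})$, such that the following holds. Let $n\ge1$, $d,D\ge1$, $\mathcal Z\subset\mathbb R^d$ open, $P_Z$ a probability distribution on $\mathcal Z$, $K>0$, $0<\sigma_{\min}<\sigma_{\max}$ with $\sigma_{\min}\le 1$. Let $\mathcal F$ be a class of functions $\mathcal Z\to\mathbb R^D$ with $\| |{\bf f}|_\infty\|_\infty\le K$ for all ${\bf f}\in\mathcal F$, and suppose that for some $s\ge1$ and $A\ge1$, $$\log N(\delta,\mathcal F,\| |\cdot|_\infty\|_\infty)\le s\{A+1\vee\log\delta^{-1}\}\quad\text{for every }\delta>0.$$ Let ${\bf f}_*:\mathcal Z\to\mathbb R^D$ and $\sigma_*\in[\sigma_{\min},\sigma_{\max}]$, and suppose there exists ${\bf f}\in\mathcal F$ with $\| |{\bf f}-{\bf f}_*|_\infty\|_\infty\le\delta_{\rm app}$, where $\delta_{\rm app}\le1$. Let ${\bf X}_1,\dots,{\bf X}_n$ be i.i.d. from $P_*=P_{{\bf f}_*,\sigma_*}$ with density $p_*=p_{{\bf f}_*,\sigma_*}$, and let $\hat p=p_{\hat{\bf f},\hat\sigma}$ where $(\hat{\bf f},\hat\sigma)\in\mathcal F\times[\sigma_{\min},\sigma_{\max}]$ satisfies $$\sum_{i=1}^n\log p_{\hat{\bf f},\hat\sigma}({\bf X}_i)\ge\sup_{{\bf f}\in\mathcal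 F,\ \sigma\in[\sigma_{\min},\sigma_{\max}]}\sum_{i=1}^n\log p_{{\bf f},\sigma}({\bf X}_i)-\eta_n.$$ Define $$\epsilon_n^*=C_3\left(\sqrt{\frac{s\{A+\log(n/\sigma_{\min})\}}{n}}\ \vee\ \frac{\delta_{\rm app}}{\sigma_*}\right).$$ If $\eta_n\le\epsilon_n^{*2}/6$ and $\epsilon_n^*\le\sqrt2\,\delta_*$, then $$P_*\big(d_H(\hat p,p_* )>\epsilon_n^*\big)\le 5e^{-C_1n\epsilon_n^{*2}}+\frac{C_2}{n}.$$
   Context: For $\sigma>0$, $\phi_\sigma$ is the density of $\mathcal N({\bf 0}_D,\sigma^2\mathbb I_D)$. For ${\bf f}:\mathcal Z\to\mathbb R^D$, $P_{{\bf f},\sigma}$ is the distribution of ${\bf f}({\bf Z})+\boldsymbol\epsilon$ with ${\bf Z}\sim P_Z$ and $\boldsymbol\epsilon\sim\mathcal N({\bf 0}_D,\sigma^2\mathbb I_D)$ independent, with density $p_{{\bf f},\sigma}({\bf x})=\int\phi_\sigma({\bf x}-{\bf f}({\bf z}))dP_Z({\bf z})$. $\| |{\bf f}|_\infty\|_\infty=\sup_{\bf z}\max_j|f_j({\bf z})|$; $N(\delta,\mathcal F,d)$ is the $\delta$-covering number. $d_H$ is the Hellinger distance. $a\vee b=\max(a,b)$. *)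

(* Defs.v *)
From HB Require Import structures.
From mathcomp Require Import all_boot all_order all_algebra.
From mathcomp Require Export all_classical all_reals all_analysis.
Set Implicit Arguments. Unset Strict Implicit. Unset Printing Implicit Defensive.
Import Order.TTheory GRing.Theory Num.Theory.
Local Open Scope ring_scope.
Local Open Scope classical_set_scope.

Section Defs.
Context {R : realType}.

(* Points of R^k are k-tuples of reals (with the product/Borel sigma-algebra
   of measurable_tuple). *)

Definition tsub (k : nat) (x y : k.-tuple R) : k.-tuple R :=
  [tuple tnth x j - tnth y j | j < k].

Definition sqnorm (k : nat) (x : k.-tuple R) : R := \sum_(j < k) tnth x j ^+ 2.

Definition open_tuple_set (d : nat) (Z : set (d.-tuple R)) : Prop :=
  forall z, Z z -> exists r : R, 0 < r /\
    forall w : d.-tuple R, (forall j, `|tnth w j - tnth z j| < r) -> Z w.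

(* Lebesgue integral over R^k of a function with values in \bar R,
   as the iterated integral of the one-dimensional Lebesgue integrals
   (equal to the integral w.r.t. k-dim Lebesgue measure for nonnegative
   measurable integrands, by Tonelli). *)
Fixpoint lebint (k : nat) : (k.-tuple R -> \bar R) -> \bar R :=
  match k return (k.-tuple R -> \bar R) -> \bar R with
  | 0 => fun g => g [tuple]
  | m.+1 => fun g =>
      (\int[@lebesgue_measure R]_x lebint (fun t : m.-tuple R => g (cons_tuple x t)))%E
  end.

Definition phi (D : nat) (sigma : R) (x : D.-tuple R) : R :=
  ((Num.sqrt (2 * pi * sigma ^+ 2))^-1) ^+ D * expR (- sqnorm x / (2 * sigma ^+ 2)).

Definition pdens (d D : nat) (Z : set (d.-tuple R)) (PZ : probability (d.-tuple R) R)
  (f : d.-tuple R -> D.-tuple R) (sigma : R) (x : D.-tuple R) : R :=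
  fine (\int[PZ]_(z in Z) (phi sigma (tsub x (f z)))%:E)%E.

Definition supdist (d D : nat) (Z : set (d.-tuple R))
  (f g : d.-tuple R -> D.-tuple R) : \bar R :=
  ereal_sup [set (`|tnth (f z) j - tnth (g z) j|)%:E | z in Z & j in [set: 'I_D]].

(* a delta-cover of F by m balls (centers need not lie in F) *)
Definition is_cover (d D : nat) (Z : set (d.-tuple R))
  (F : set (d.-tuple R -> D.-tuple R)) (delta : R) (m : nat)
  (c : 'I_m -> d.-tuple R -> D.-tuple R) : Prop :=
  forall f, F f -> exists i : 'I_m, (supdist Z f (c i) <= delta%:E)%E.

(* covering number N(delta, F, || |.|_oo ||_oo), +oo if no finite cover *)
Definition covering_number (d D : nat) (Z : set (d.-tuple R))
  (F : set (d.-tuple R -> D.-tuple R)) (delta : R) : \bar R :=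
  ereal_inf [set (m%:R)%:E | m in [set m : nat | exists c, @is_cover d D Z F delta m c]].

Definition hellinger (D : nat) (p q : D.-tuple R -> R) : R :=
  Num.sqrt (fine (lebint (fun x => ((Num.sqrt (p x) - Num.sqrt (q x)) ^+ 2)%:E))).

End Defs.

(* Main.v *)
Require Import Defs.
From HB Require Import structures.
From mathcomp Require Import all_boot all_order all_algebra.
From mathcomp Require Import all_classical all_reals all_analysis.
From mathcomp Require Import measurable_realfun ring lra.
Set Implicit Arguments. Unset Strict Implicit. Unset Printing Implicit Defensive.
Import Order.TTheory GRing.Theory Num.Theory.
Local Open Scope ring_scope.
Local Open Scope classical_set_scope.

(** With [rho = 1/n], a Gaussian mixture [p_{f,s}] is dominated pointwise by
    [exp(3 rho D) p_{c,s'}] whenever [|f - c| <= rho sigma_min] and [s'/s] lies in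
    [[1 + rho, (1 + rho)^2]]. A sup-norm cover of [F] and an arithmetic grid of scales thus
    give finitely many multiples of mixture densities that dominate the whole model, with
    log-cardinality of order [s (A + log (n / sigma_min))]. If [p <= e^m q] and [p] is at
    Hellinger distance more than [eps] from [p_star], the affinity of [q] and [p_star] is at most
    [exp(m/2 - eps^2/4)], so by Markov's inequality for the product of [sqrt(q/p_star)] and a
    union bound no such [p] has a large likelihood. On the other hand, by convexity of
    [p^2/q] the likelihood ratio [p_star/p_{f,sigma_star}] of a good approximant [f] has mean at most
    [exp(D (delta_app/sigma_star)^2)], and Markov's inequality bounds the likelihood of that
    approximant from below. One covering scale suffices, and [C2 = 0], [delta_star = 1] work. *)

(** * Weighted laws of random variables are determined by their values on sets *)

Section weighted_integral.
Import HBNNSimple.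
Context {R : realType}.

(** Simple functions increase to [g] and monotone convergence applies. The right-hand side sees
    weight and variable only through the integrals of [W] over the events that [X] falls in a level
    set. *)
Lemma ge0_integral_weight_approx d (T : measurableType d) (mu : measure T R)
    dS (S : measurableType dS) (W : T -> R) (X : T -> S) (g : S -> \bar R)
    (mg : measurable_fun setT g) :
  measurable_fun setT W -> (forall x, 0 <= W x) -> measurable_fun setT X ->
  (forall s, (0 <= g s)%E) ->
  (\int[mu]_x ((W x)%:E * g (X x)) =
   limn (fun n => \sum_(y \in range (nnsfun_approx measurableT mg n))
     (y%:E * \int[mu]_x (W x * \1_(nnsfun_approx measurableT mg n @^-1` [set y]) (X x))%:E)))%E.
Proof.
move=> mW W0 mX g0.
set h := nnsfun_approx measurableT mg.
transitivity (\int[mu]_x limn (fun n => (W x * h n (X x))%:E))%E.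
  apply: eq_integral => x _; apply/esym/cvg_lim => //.
  under eq_fun do rewrite EFinM.
  by apply: cvgeZl => //; exact: cvg_nnsfun_approx.
rewrite monotone_convergence//; last 3 first.
- move=> n; apply/measurable_EFinP; apply: measurable_funM => //.
  exact: measurableT_comp.
- by move=> n x _; rewrite lee_fin mulr_ge0.
- move=> x _ m n mn; rewrite lee_fin ler_wpM2l//.
  exact/lefP/nd_nnsfun_approx.
congr (limn _); apply/funext => n.
transitivity (\int[mu]_x (\sum_(y \in range (h n))
    (y * (W x * \1_(h n @^-1` [set y]) (X x)))%:E)%R)%E.
  apply: eq_integral => x _; rewrite fsumEFin//; congr EFin.
  rewrite [in LHS]fimfunE mulr_fsumr//.
  by apply: eq_fsbigr => y _; rewrite mulrCA.
have mE y : measurable_fun setT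
    (fun x => (W x * \1_(h n @^-1` [set y]) (X x))%:E).
  apply/measurable_EFinP; apply: measurable_funM => //.
  have m1 : measurable_fun setT (\1_(h n @^-1` [set y]) : S -> R).
    exact: measurable_indic.
  exact: (measurableT_comp m1 mX).
rewrite ge0_integral_fsum//; last 2 first.
- move=> y; under eq_fun do rewrite EFinM.
  by apply: emeasurable_funM => //; exact: measurable_cst.
- move=> y x _; rewrite lee_fin mulrCA mulr_ge0//.
  rewrite indicE; case: (boolP (_ \in _)) => [|_]; last by rewrite mulr0.
  by rewrite inE /= mulr1 => <-.
apply: eq_fsbigr => y /[!inE] -[s _ <-].
under eq_integral do rewrite EFinM.
rewrite ge0_integralZl_EFin//.
by move=> x _; rewrite lee_fin mulr_ge0.
Qed.

(** Both sides use the same simple approximation of [g], so agreement on indicators is enough. It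
    serves twice: to free one factor in a product over independent variables, and to pass from the
    law of [X i] to its density. *)
Lemma ge0_integral_weight_ext d1 (T1 : measurableType d1) (mu1 : measure T1 R)
    d2 (T2 : measurableType d2) (mu2 : measure T2 R)
    dS (S : measurableType dS) (W1 : T1 -> R) (W2 : T2 -> R)
    (X1 : T1 -> S) (X2 : T2 -> S) :
  measurable_fun setT W1 -> (forall x, 0 <= W1 x) -> measurable_fun setT X1 ->
  measurable_fun setT W2 -> (forall x, 0 <= W2 x) -> measurable_fun setT X2 ->
  (forall B, measurable B -> \int[mu1]_x (W1 x * \1_B (X1 x))%:E =
                             \int[mu2]_x (W2 x * \1_B (X2 x))%:E)%E ->
  forall g : S -> \bar R, measurable_fun setT g -> (forall s, (0 <= g s)%E) ->
  (\int[mu1]_x ((W1 x)%:E * g (X1 x)) = \int[mu2]_x ((W2 x)%:E * g (X2 x)))%E.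
Proof.
move=> mW1 W10 mX1 mW2 W20 mX2 H g mg g0.
rewrite !(ge0_integral_weight_approx _ mg)//.
congr (limn _); apply/funext => n; apply: eq_fsbigr => y _.
by rewrite H//; exact: measurable_funPTI.
Qed.

End weighted_integral.

(** * Expectation of a product of functions of independent variables *)

Section independence.
Context {R : realType} {d} {T : measurableType d} (P : probability T R).
Context {dS} {S : measurableType dS} {n : nat} (X : 'I_n -> T -> S).
Hypothesis mX : forall i, measurable_fun setT (X i).
Hypothesis indep : forall B : 'I_n -> set S, (forall i, measurable (B i)) ->
  P (\bigcap_(i in [set: 'I_n]) (X i @^-1` B i))
    = (\prod_(i < n) P (X i @^-1` B i))%E.

(** Induction on the number [k] of leading factors that may be arbitrary, the others being
    indicators. For [k = 0] this is independence of events. The step frees factor [k], with the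
    product of the other factors as weight. *)
Lemma integral_prod_indep_indic k (g : 'I_n -> S -> R) (e : 'I_n -> R) :
  (forall i, measurable_fun setT (g i)) -> (forall i s, 0 <= g i s) ->
  (forall i, \int[P]_w (g i (X i w))%:E = (e i)%:E)%E ->
  (forall i : 'I_n, (k <= i)%N -> exists2 B, measurable B & g i = \1_B) ->
  (\int[P]_w (\prod_(i < n) g i (X i w))%:E = (\prod_(i < n) e i)%:E)%E.
Proof.
elim: k g e => [|k IH] g e mg g0 ge gB.
  have /choice[B HB] : forall i, exists B, measurable B /\ g i = \1_B.
    by move=> i; have [B mB ->] := gB i (leq0n _); exists B.
  have mB i : measurable (B i) by have [] := HB i.
  have gE i : g i = \1_(B i) by have [] := HB i.
  have mXB i : measurable (X i @^-1` B i).
    by rewrite -[X in measurable X]setTI; exact: mX.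
  have PXB i : P (X i @^-1` B i) = (e i)%:E.
    rewrite -ge gE -[RHS]/(\int[P]_w (\1_(X i @^-1` B i) w)%:E)%E.
    by rewrite integral_indic// setIT.
  transitivity (\int[P]_w (\1_(\bigcap_(i in [set: 'I_n]) (X i @^-1` B i)) w)%:E)%E.
    apply: eq_integral => w _; congr EFin.
    under eq_bigr do rewrite gE indicE.
    rewrite indicE; case: (boolP (w \in _)) => [|/negP].
      rewrite inE => Bw; rewrite big1// => i _.
      by rewrite mem_set//; exact: Bw.
    rewrite inE => nBw; have [i nBi] : exists i, ~ B i (X i w).
      apply: contrapT => /forallNP H; apply: nBw => i _ /=.
      by apply: contrapT; exact: H.
    by apply/eqP; rewrite prodf_seq_eq0; apply/hasP; exists i; rewrite ?mem_index_enum// memNset//=.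
  rewrite integral_indic//; last first.
    by apply: fin_bigcap_measurable => //; exact: finite_finset.
  rewrite setIT; transitivity (\prod_(i < n) P (X i @^-1` B i))%E.
    exact: indep.
  by under eq_bigr do rewrite PXB; rewrite prodEFin.
(* For [k >= n] there is no factor of index [k], and the induction hypothesis applies as it
   stands. *)
have [kn|nk] := ltnP k n; last first.
  by apply: IH => // i ki; have := ltn_ord i; rewrite ltnNge (leq_trans nk).
pose ik := Ordinal kn.
pose W w := \prod_(i < n | i != ik) g i (X i w).
pose C := \prod_(i < n | i != ik) e i.
have e0 i : 0 <= e i.
  by rewrite -lee_fin -ge; apply: integral_ge0 => w _; rewrite lee_fin.
have C0 : 0 <= C by exact: prodr_ge0.
have mgX i : measurable_fun setT (g i \o X i) by exact: measurableT_comp.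
have mW : measurable_fun setT W.
  rewrite /W; under eq_fun do rewrite -big_filter.
  by apply: measurable_prod => i _; exact: mgX.
have W0 w : 0 <= W w by exact: prodr_ge0.
transitivity (\int[P]_w ((W w)%:E * (g ik (X ik w))%:E))%E.
  by apply: eq_integral => w _; rewrite (bigD1 ik)//= EFinM muleC.
(* On the right the weight is the constant [C], so only indicators of [X ik] remain to be compared;
   there the induction hypothesis applies to the family whose factor [ik] is replaced by [\1_B]. *)
rewrite (@ge0_integral_weight_ext _ _ _ P _ _ P _ _ _ (cst C) _ (X ik) _ _ _ _ _ _ _
  (EFin \o g ik))//=; last 3 first.
- move=> B mB.
  have mXB : measurable (X ik @^-1` B).
    by rewrite -[X in measurable X]setTI; exact: mX.
  pose e' i := if i == ik then fine (P (X ik @^-1` B)) else e i.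
  pose g' i := if i == ik then \1_B else g i.
  have e'E : \prod_(i < n) e' i = C * fine (P (X ik @^-1` B)).
    rewrite (bigD1 ik)//= mulrC; congr (_ * _); last by rewrite /e' eqxx.
    by apply: eq_bigr => i /negbTE; rewrite /e' => ->.
  transitivity (\int[P]_w (\prod_(i < n) g' i (X i w))%:E)%E.
    apply: eq_integral => w _; rewrite [in RHS](bigD1 ik)//= mulrC.
    congr ((_ * _)%:E); first by rewrite /g' eqxx.
    by apply: eq_bigr => i /negbTE; rewrite /g' => ->.
  rewrite (IH g' e') ?e'E.
  + transitivity (\int[P]_w (C%:E * (\1_(X ik @^-1` B) w)%:E))%E; last by [].
    rewrite ge0_integralZl_EFin//.
    * by rewrite integral_indic// setIT EFinM fineK// fin_num_measure.
    * by apply/measurable_EFinP; exact: measurable_indic.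
  + by move=> i; rewrite /g'; case: ifPn.
  + by move=> i s; rewrite /g'; case: ifPn.
  + move=> i; rewrite /g' /e'; case: ifPn => // /eqP ->.
    rewrite -[LHS]/(\int[P]_w (\1_(X ik @^-1` B) w)%:E)%E.
    by rewrite integral_indic// setIT fineK// fin_num_measure.
  + move=> i ki; rewrite /g'; case: ifPn => [_|iik]; first by exists B.
    apply: gB; rewrite ltn_neqAle ki andbT.
    by apply: contra iik => /eqP ki'; apply/eqP/val_inj.
- exact/measurable_EFinP.
- by move=> s; rewrite lee_fin.
rewrite ge0_integralZl_EFin//.
- by rewrite ge (bigD1 ik)//= mulrC EFinM.
- by move=> w _; rewrite lee_fin.
- by apply/measurable_EFinP; exact: mgX.
Qed.

Lemma integral_prod_indep (g : 'I_n -> S -> R) (e : 'I_n -> R) :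
  (forall i, measurable_fun setT (g i)) -> (forall i s, 0 <= g i s) ->
  (forall i, \int[P]_w (g i (X i w))%:E = (e i)%:E)%E ->
  (\int[P]_w (\prod_(i < n) g i (X i w))%:E = (\prod_(i < n) e i)%:E)%E.
Proof.
move=> mg g0 ge; apply: (@integral_prod_indep_indic n) => // i ni.
by have := ltn_ord i; rewrite ltnNge ni.
Qed.

End independence.

(** * The iterated Lebesgue integral as integration against a measure; measurability of open sets *)

Section lebint_theory.
Context {R : realType}.

(** Makes monotone convergence and Tonelli's theorem available for [lebint]. By induction the
    measure is the image under [cons_tuple] of the product of Lebesgue measure and [mu];
    sigma-finiteness is carried along because Tonelli's theorem asks for it. *)
Lemma lebint_measure k :
  exists mu : {sigma_finite_measure set (k.-tuple R) -> \bar R},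
  forall g : k.-tuple R -> \bar R, measurable_fun setT g ->
    (forall x, (0 <= g x)%E) -> lebint g = (\int[mu]_x g x)%E.
Proof.
elim: k => [|k [mu IH]].
  pose mu0 : {sigma_finite_measure set (0.-tuple R) -> \bar R} :=
    @dirac _ (0.-tuple R) [tuple] R.
  exists mu0 => g mg g0 /=.
  by rewrite integral_dirac//= diracT mul1e.
pose c (p : measurableTypeR R * k.-tuple R) : k.+1.-tuple R := cons_tuple p.1 p.2.
have mc : measurable_fun setT c.
  by apply: measurable_cons; [exact: measurable_fst|exact: measurable_snd].
pose h (t : k.+1.-tuple R) : measurableTypeR R * k.-tuple R := (thead t, [tuple of behead t]).
have mh : measurable_fun setT h.
  apply: measurable_fun_pair; last exact: measurable_behead.
  exact: measurable_tnth.
have hc p : h (c p) = p.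
  case: p => x t; rewrite /h /c /=; congr pair.
  by apply: val_inj.
pose leb : {sigma_finite_measure set (measurableTypeR R) -> \bar R} := @lebesgue_measure R.
pose prodmu : measure _ _ := (leb \x mu)%E.
pose nu := measure_function_pushforward__canonical__measure_function_Measure
  prodmu mc.
(* The exhausting sets are preimages of rectangles under [h], which undoes [c]. The exhaustions of
   both factors are increasing, so a single index serves both coordinates. *)
have sfnu : sigma_finite setT nu.
  have /sigma_finiteP[F [FT ndF mF]] := sigma_finiteT leb.
  have /sigma_finiteP[G [GT ndG mG]] := sigma_finiteT mu.
  exists (fun i => h @^-1` (F i `*` G i)).
    rewrite -preimage_bigcup (_ : \bigcup_i _ = setT)//.
    apply/seteqP; split => // -[x t] _.
    have [i _ Fi] : (\bigcup_i F i) x by rewrite -FT.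
    have [j _ Gj] : (\bigcup_i G i) t by rewrite -GT.
    exists (maxn i j) => //; split => /=.
      by apply: (subsetPset _ _ (ndF i _ _)) Fi; exact: leq_maxl.
    by apply: (subsetPset _ _ (ndG j _ _)) Gj; exact: leq_maxr.
  move=> i; have [mFi Fioo] := mF i; have [mGi Gioo] := mG i.
  have mFG : measurable (F i `*` G i) by exact: measurableX.
  split; first by rewrite -[X in measurable X]setTI; exact: mh.
  rewrite /nu /= /pushforward.
  rewrite (_ : c @^-1` _ = F i `*` G i).
    by rewrite /prodmu /= product_measure1E// lte_mul_pinfty// ge0_fin_numE.
  by apply/funext => p; rewrite /preimage /mkset hc.
pose mixin := Measure_isSigmaFinite.Build _ _ _ nu sfnu.
pose nu' : {sigma_finite_measure set (k.+1.-tuple R) -> \bar R} :=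
  HB.pack (nu : set _ -> \bar R) (Measure.class nu) mixin.
exists nu' => g mg g0 /=.
have -> : (\int[nu']_x g x = \int[prodmu]_p g (c p))%E.
  by rewrite -[LHS]/(\int[pushforward prodmu c]_x g x)%E ge0_integral_pushforward.
have mgc : measurable_fun setT (g \o c) by exact: measurableT_comp.
rewrite -[RHS]/(\int[leb \x mu]_p (g \o c) p)%E fubini_tonelli1//; last first.
  by move=> p; exact: g0.
apply: eq_integral => x _; rewrite IH//.
exact: (measurable_fun_pair2 x mgc).
Qed.

Definition lebm k : {sigma_finite_measure set (k.-tuple R) -> \bar R} :=
  projT1 (cid (lebint_measure k)).

Lemma lebintE k (g : k.-tuple R -> \bar R) : measurable_fun setT g ->
  (forall x, (0 <= g x)%E) -> lebint g = (\int[lebm k]_x g x)%E.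
Proof. exact: (projT2 (cid (lebint_measure k))). Qed.

(** The constant [c] collects the factors of the coordinates fixed by the outer integrals, which
    lets the induction close. *)
Lemma lebint_prod k (h : 'I_k -> R -> R) (c : R) :
  (forall j, measurable_fun setT (h j)) -> (forall j x, 0 <= h j x) ->
  (forall j, \int[@lebesgue_measure R]_x (h j x)%:E = 1)%E -> 0 <= c ->
  lebint (fun x : k.-tuple R => (c * \prod_(j < k) h j (tnth x j))%:E) = c%:E.
Proof.
move=> mh h0 h1.
elim: k h c mh h0 h1 => [|k IH] h c mh h0 h1 c0 /=.
  by rewrite big_ord0 mulr1.
transitivity (\int[@lebesgue_measure R]_x (c%:E * (h ord0 x)%:E))%E.
  apply: eq_integral => x _; rewrite -EFinM.
  rewrite -(IH (fun j => h (lift ord0 j)) (c * h ord0 x))//; last exact: mulr_ge0.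
  congr (lebint _); apply/funext => t; congr EFin.
  rewrite big_ord_recl mulrA; congr (_ * _).
  by apply: eq_bigr => j _; congr (h _ _); rewrite tnthS.
rewrite ge0_integralZl_EFin//.
- by rewrite h1 mule1.
- by move=> x _; rewrite lee_fin.
- by apply/measurable_EFinP; exact: mh.
Qed.

(** An open set is the union of the boxes with rational endpoints that it contains, and there are
    countably many such boxes. *)
Lemma open_tuple_set_measurable k (Z : set (k.-tuple R)) :
  open_tuple_set Z -> measurable Z.
Proof.
move=> oZ.
pose box (u : k.-tuple rat * k.-tuple rat) : set (k.-tuple R) :=
  \bigcap_(j in [set: 'I_k])
    (@tnth k R ^~ j) @^-1` `]ratr (tnth u.1 j), ratr (tnth u.2 j)[%classic.
pose F u := if `[< box u `<=` Z >] then box u else set0.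
suff -> : Z = \bigcup_u F u.
  apply: countable_bigcupT_measurable; first exact: countableP.
  move=> u; rewrite /F; case: ifPn => // _.
  apply: fin_bigcap_measurable => [|j _]; first exact: finite_finset.
  by rewrite -[X in measurable X]setTI; apply: measurable_tnth.
apply/seteqP; split => [z Zz|z [u _]]; last first.
  by rewrite /F; case: ifPn => // /asboolP; apply.
have [r [r0 rZ]] := oZ _ Zz.
have ab j : exists q : rat * rat,
    tnth z j - r < ratr q.1 < tnth z j /\ tnth z j < ratr q.2 < tnth z j + r.
  have /rat_in_itvoo[a] : tnth z j - r < tnth z j by rewrite ltrBlDr ltrDl.
  have /rat_in_itvoo[b] : tnth z j < tnth z j + r by rewrite ltrDl.
  by rewrite !in_itv /= => ? ?; exists (a, b).
have [q Hq] := choice ab.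
exists ([tuple (q j).1 | j < k], [tuple (q j).2 | j < k]) => //.
rewrite /F ifT.
  move=> j _ /=; rewrite in_itv /= !tnth_mktuple.
  by have [/andP[_ ->] /andP[-> _]] := Hq j.
apply/asboolP => w bw; apply: rZ => j.
have := bw j Logic.I; rewrite /= in_itv /= !tnth_mktuple => /andP[w1 w2].
have [/andP[a1 a2] /andP[b1 b2]] := Hq j.
rewrite ltr_distl; apply/andP; split.
  by apply: lt_trans w1.
exact: lt_trans b2.
Qed.

End lebint_theory.

(** * The Gaussian kernel: product form, bounds, normalisation *)

Section gaussian.
Context {R : realType} {D : nat}.

Lemma phi_prod (s : R) (x m : D.-tuple R) : 0 < s ->
  phi s (tsub x m) = \prod_(j < D) normal_pdf (tnth m j) s (tnth x j).
Proof.
move=> s0; under eq_bigr do rewrite normal_pdfE ?gt_eqF//.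
rewrite big_split/= prodr_const card_ord /phi; congr (_ * _).
  by rewrite /normal_peak (_ : s ^+ 2 * pi *+ 2 = 2 * pi * s ^+ 2)//; ring.
rewrite /normal_fun -expR_sum; congr expR.
rewrite /sqnorm mulNr mulr_suml -sumrN; apply: eq_bigr => j _.
by rewrite tnth_mktuple mulNr (mulr_natl _ 2).
Qed.

Lemma phi_gt0 (s : R) (x : D.-tuple R) : 0 < s -> 0 < phi s x.
Proof.
move=> s0; rewrite /phi mulr_gt0 ?expR_gt0// exprn_gt0// invr_gt0 sqrtr_gt0.
by rewrite !mulr_gt0// ?pi_gt0// exprn_gt0.
Qed.

Lemma phi_le (s : R) (x : D.-tuple R) : 0 < s ->
  phi s x <= ((Num.sqrt (2 * pi * s ^+ 2))^-1) ^+ D.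
Proof.
move=> s0; rewrite /phi ler_piMr ?exprn_ge0 ?invr_ge0 ?sqrtr_ge0//.
rewrite -[leRHS]expR0 ler_expR mulNr oppr_le0 divr_ge0 ?sumr_ge0//.
  by move=> j _; rewrite sqr_ge0.
by rewrite mulr_ge0// sqr_ge0.
Qed.

Lemma measurable_phi_tsub d (T : measurableType d) (s : R)
    (X Y : T -> D.-tuple R) :
  measurable_fun setT X -> measurable_fun setT Y ->
  measurable_fun setT (fun t => phi s (tsub (X t) (Y t))).
Proof.
move=> mX mY; rewrite /phi; apply: measurable_funM => //.
apply: measurableT_comp => //; apply: measurable_funM => //.
apply: measurableT_comp => //; apply: measurable_sum => j.
under eq_fun do rewrite tnth_mktuple.
apply: measurable_funX; apply: measurable_funB.
  by move/measurable_fun_tnthP : mX => /(_ j).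
by move/measurable_fun_tnthP : mY => /(_ j).
Qed.

Lemma lebint_phi (s : R) (m : D.-tuple R) : 0 < s ->
  lebint (fun x => (phi s (tsub x m))%:E) = 1%E.
Proof.
move=> s0.
rewrite -(@lebint_prod R D (fun j => normal_pdf (tnth m j) s) 1)//.
- by congr (lebint _); apply/funext => x; rewrite phi_prod// mul1r.
- by move=> j; exact: measurable_normal_pdf.
- by move=> j x; exact: normal_pdf_ge0.
- by move=> j; exact: integral_normal_pdf.
Qed.

End gaussian.

(** * Gaussian mixtures as positive probability densities *)

Section mixture.
Context {R : realType} {d D : nat} {Z : set (d.-tuple R)}.
Context {PZ : probability (d.-tuple R) R}.
Hypotheses (mZ : measurable Z) (PZ1 : PZ Z = 1%E).
Implicit Types (f : d.-tuple R -> D.-tuple R) (s : R).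

Lemma measurable_phi_mixture s f x : measurable_fun Z f ->
  measurable_fun Z (fun z => (phi s (tsub x (f z)))%:E).
Proof.
move=> mf; apply/measurable_EFinP.
have mphi : measurable_fun setT (fun y : D.-tuple R => phi s (tsub x y)).
  by apply: measurable_phi_tsub => //; exact: measurable_cst.
exact: (measurableT_comp mphi mf).
Qed.

(** The kernel is bounded and [PZ] has mass one, so the integral is finite and [fine] loses
    nothing. *)
Lemma pdensE s f x : 0 < s -> measurable_fun Z f ->
  ((pdens Z PZ f s x)%:E = \int[PZ]_(z in Z) (phi s (tsub x (f z)))%:E)%E.
Proof.
move=> s0 mf; rewrite /pdens fineK// ge0_fin_numE; last first.
  by apply: integral_ge0 => z _; rewrite lee_fin ltW// phi_gt0.
pose c := ((Num.sqrt (2 * pi * s ^+ 2))^-1) ^+ D : R.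
apply: (@le_lt_trans _ _ (\int[PZ]_(z in Z) c%:E)%E).
  apply: ge0_le_integral => //.
  - by move=> z _; rewrite lee_fin ltW// phi_gt0.
  - exact: measurable_phi_mixture.
  - by move=> z _; rewrite lee_fin phi_le.
by rewrite integral_cst// [X in (_ * X)%E]PZ1 mule1 ltry.
Qed.

(** A vanishing integral would force the kernel to be zero almost everywhere on [Z], yet it is
    positive throughout and [Z] has mass one. *)
Lemma pdens_gt0 s f x : 0 < s -> measurable_fun Z f -> 0 < pdens Z PZ f s x.
Proof.
move=> s0 mf; rewrite -lte_fin pdensE// lt_neqAle; apply/andP; split; last first.
  by apply: integral_ge0 => z _; rewrite lee_fin ltW// phi_gt0.
apply/negP => /eqP int0.
have /ae_eq_integral_abs : measurable_fun Z (fun z => (phi s (tsub x (f z)))%:E).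
  exact: measurable_phi_mixture.
move=> /(_ PZ mZ)[+ _].
under eq_integral do rewrite gee0_abs ?lee_fin ?(ltW (phi_gt0 _ _))//.
move=> /(_ (esym int0)) => -[N [mN N0 ZN]].
have : (PZ Z <= PZ N)%E.
  apply: le_measure; rewrite ?inE// => z Zz; apply: ZN => /= /(_ Zz) [].
  by move=> /eqP; rewrite gt_eqF// phi_gt0.
by rewrite PZ1 N0 lee_fin ler10.
Qed.

(** [f] is measurable on [Z] only; the zero extension gives a kernel that is jointly measurable on
    the whole product space, as Tonelli's theorem requires. *)
Definition zext f z : D.-tuple R := if z \in Z then f z else [tuple 0 | _ < D].

Lemma measurable_zext f : measurable_fun Z f -> measurable_fun setT (zext f).
Proof.
move=> mf; have ZE : (fun z => z \in Z) @^-1` [set true] = Z.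
  by apply/seteqP; split => z; [exact: set_mem|exact: mem_set].
apply: measurable_fun_if => //.
- apply: (@measurable_fun_bool _ _ _ _ true).
  by rewrite setTI ZE.
- by rewrite setTI ZE.
Qed.

Let kern s f (p : D.-tuple R * d.-tuple R) : \bar R :=
  (\1_Z p.2 * phi s (tsub p.1 (zext f p.2)))%:E.

Let kern_ge0 s f p : 0 < s -> (0 <= kern s f p)%E.
Proof. by move=> s0; rewrite lee_fin mulr_ge0// ltW// phi_gt0. Qed.

Let measurable_kern s f : measurable_fun Z f -> measurable_fun setT (kern s f).
Proof.
move=> mf; apply/measurable_EFinP; apply: measurable_funM.
  have m1 : measurable_fun setT (\1_Z : _ -> R) by exact: measurable_indic.
  exact: (measurableT_comp m1 measurable_snd).
apply: measurable_phi_tsub; first exact: measurable_fst.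
exact: (measurableT_comp (measurable_zext mf) measurable_snd).
Qed.

Let integral_kern s f x :
  (\int[PZ]_(z in Z) (phi s (tsub x (f z)))%:E = \int[PZ]_z kern s f (x, z))%E.
Proof.
rewrite integral_mkcond; apply: eq_integral => z _.
rewrite /kern /= indicE patchE /zext; case: ifPn => _; last by rewrite mul0r.
by rewrite mul1r.
Qed.

Lemma measurable_pdens s f : 0 < s -> measurable_fun Z f ->
  measurable_fun setT (pdens Z PZ f s).
Proof.
move=> s0 mf; apply/measurable_EFinP.
rewrite (_ : EFin \o _ = fun x => \int[PZ]_z kern s f (x, z))%E; last first.
  by apply/funext => x /=; rewrite pdensE// integral_kern.
apply: measurable_fun_fubini_tonelli_F; first exact: measurable_kern.
by move=> p; exact: kern_ge0.
Qed.

(** Tonelli's theorem: for fixed [z] the Gaussian kernel has mass one, which leaves [PZ Z]. *)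
Lemma lebint_pdens s f : 0 < s -> measurable_fun Z f ->
  lebint (fun x => (pdens Z PZ f s x)%:E) = 1%E.
Proof.
move=> s0 mf.
rewrite lebintE; last 2 first.
- by apply/measurable_EFinP; exact: measurable_pdens.
- by move=> x; rewrite lee_fin ltW// pdens_gt0.
under eq_integral do rewrite pdensE// integral_kern.
rewrite (@fubini_tonelli _ _ _ _ _ (lebm D) PZ (kern s f))//; last 2 first.
- exact: measurable_kern.
- by move=> p; exact: kern_ge0.
transitivity (\int[PZ]_z (\1_Z z)%:E)%E; last by rewrite integral_indic// setIT.
apply: eq_integral => z _; rewrite /kern /=.
have mp : measurable_fun setT (fun x => (phi s (tsub x (zext f z)))%:E).
  by apply/measurable_EFinP; apply: measurable_phi_tsub => //; exact: measurable_cst.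
under eq_integral do rewrite EFinM.
rewrite ge0_integralZl_EFin//.
  rewrite -lebintE ?lebint_phi ?mule1// => x.
  by rewrite lee_fin ltW// phi_gt0.
by move=> x _; rewrite lee_fin ltW// phi_gt0.
Qed.

(** Carries pointwise comparisons of kernels over to mixtures: one term on the right serves for
    brackets, two for the quadratic bound. *)
Lemma pdens_le_lin (a b c s1 s2 s3 : R) f1 f2 f3 x :
  0 <= a -> 0 <= b -> 0 <= c -> 0 < s1 -> 0 < s2 -> 0 < s3 ->
  measurable_fun Z f1 -> measurable_fun Z f2 -> measurable_fun Z f3 ->
  (forall z, Z z -> a * phi s1 (tsub x (f1 z)) <=
     b * phi s2 (tsub x (f2 z)) + c * phi s3 (tsub x (f3 z))) ->
  a * pdens Z PZ f1 s1 x <= b * pdens Z PZ f2 s2 x + c * pdens Z PZ f3 s3 x.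
Proof.
move=> a0 b0 c0 s10 s20 s30 mf1 mf2 mf3 H.
have phi0 s f z : 0 < s -> (0 <= (phi s (tsub x (f z)))%:E)%E.
  by move=> s0; rewrite lee_fin ltW// phi_gt0.
have mE (e s : R) f : measurable_fun Z f ->
    measurable_fun Z (fun z => e%:E * (phi s (tsub x (f z)))%:E)%E.
  move=> mf; apply: emeasurable_funM; first exact: measurable_cst.
  exact: measurable_phi_mixture.
rewrite -lee_fin !EFinD !EFinM !pdensE// -!ge0_integralZl_EFin//;
  try (by move=> z _; exact: phi0); try exact: measurable_phi_mixture.
rewrite -ge0_integralD//; try (by move=> z _; rewrite mule_ge0// phi0);
  try exact: mE.
apply: ge0_le_integral => //.
- by move=> z _; rewrite mule_ge0// phi0.
- exact: mE.
- by apply: emeasurable_funD; exact: mE.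
Qed.

End mixture.

(** * Pointwise comparison of shifted and rescaled Gaussians *)

Section gaussian_comparison.
Context {R : realType}.

(** Completing the square: the difference of exponents is a square plus
    [r ^+ 2 * (del ^+ 2 - (m - c) ^+ 2)], over a positive denominator. Widening by [r > 1] pays for
    the shift of the mean, and the prefactor [r] compensates the lower peak. *)
Lemma normal_pdf_scale (s r del m c x : R) : 0 < s -> 1 < r -> `|m - c| <= del ->
  normal_pdf m s x <=
  r * expR (del ^+ 2 / (2 * s ^+ 2 * (r ^+ 2 - 1))) * normal_pdf c (r * s) x.
Proof.
move=> s0 r1 mc.
have r0 : 0 < r by exact: lt_trans r1.
rewrite !normal_pdfE ?gt_eqF ?mulr_gt0//.
have -> : normal_peak s = r * normal_peak (r * s) :> R.
  rewrite /normal_peak (_ : (r * s) ^+ 2 * pi *+ 2 = r ^+ 2 * (s ^+ 2 * pi *+ 2)).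
    by rewrite sqrtrM ?sqr_ge0// sqrtr_sqr gtr0_norm// invfM mulrA divff ?mul1r ?gt_eqF.
  by ring.
rewrite -!mulrA ler_pM2l// mulrCA ler_wpM2l ?normal_peak_ge0//.
rewrite -expRD ler_expR.
have y2 : (m - c) ^+ 2 <= del ^+ 2.
  by rewrite -real_normK ?num_real// lerXn2r ?nnegrE// (le_trans _ mc).
have a1 : 0 < r ^+ 2 - 1 by rewrite subr_gt0 exprn_egt1.
have ss0 : 0 < s ^+ 2 by rewrite exprn_gt0.
have rr0 : 0 < r ^+ 2 by rewrite exprn_gt0.
rewrite -subr_ge0 (_ : _ - _ =
  (((r ^+ 2 - 1) * (x - c) - r ^+ 2 * (m - c)) ^+ 2 +
    r ^+ 2 * (del ^+ 2 - (m - c) ^+ 2)) / (2 * s ^+ 2 * r ^+ 2 * (r ^+ 2 - 1))).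
  rewrite divr_ge0 ?addr_ge0 ?sqr_ge0//.
    by rewrite mulr_ge0 ?subr_ge0// ltW.
  by rewrite !mulr_ge0// ltW.
field.
by rewrite !gt_eqF.
Qed.

Lemma phi_scale D (s r del : R) (x m c : D.-tuple R) : 0 < s -> 1 < r ->
  (forall j, `|tnth m j - tnth c j| <= del) ->
  phi s (tsub x m) <=
  (r * expR (del ^+ 2 / (2 * s ^+ 2 * (r ^+ 2 - 1)))) ^+ D * phi (r * s) (tsub x c).
Proof.
move=> s0 r1 mc; rewrite !phi_prod ?mulr_gt0 ?(lt_trans _ r1)//.
rewrite -[X in _ ^+ X]card_ord -prodr_const -big_split/=.
apply: ler_prod => j _; rewrite normal_pdf_ge0/=.
exact: normal_pdf_scale.
Qed.

(* Parallelogram identity at [x - a]: [phi(x-a)^2 = exp(|a-b|^2/s^2) phi(x-(2a-b)) phi(x-b)]. *)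
Lemma phi_sqr_le D (s del : R) (x a b g : D.-tuple R) : 0 < s ->
  (forall j, `|tnth b j - tnth a j| <= del) ->
  (forall j, tnth g j = 2 * tnth a j - tnth b j) ->
  phi s (tsub x a) ^+ 2 <=
  expR (D%:R * (del / s) ^+ 2) * phi s (tsub x g) * phi s (tsub x b).
Proof.
move=> s0 ab gE; rewrite /phi.
set C := (_ ^-1) ^+ D.
have C0 : 0 <= C by rewrite exprn_ge0// invr_ge0 sqrtr_ge0.
set ea := expR (- sqnorm (tsub x a) / _); set eg := expR (- sqnorm (tsub x g) / _).
set eb := expR (- sqnorm (tsub x b) / _); set E := expR (D%:R * _).
rewrite (_ : E * _ * _ = C ^+ 2 * (E * (eg * eb))); last by ring.
rewrite exprMn ler_wpM2l ?sqr_ge0// /ea /eg /eb /E.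
rewrite -expRM_natl -!expRD ler_expR.
rewrite -subr_ge0 (_ : _ - _ = \sum_(j < D)
   ((del ^+ 2 - (tnth b j - tnth a j) ^+ 2) / s ^+ 2)).
  apply: sumr_ge0 => j _; rewrite divr_ge0 ?sqr_ge0// subr_ge0.
  by rewrite -real_normK ?num_real// lerXn2r ?nnegrE// (le_trans _ (ab j)).
have ss : s ^+ 2 != 0 by rewrite expf_eq0/= gt_eqF.
rewrite -mulr_suml sumrB sumr_const card_ord.
have -> : \sum_(j < D) (tnth b j - tnth a j) ^+ 2 =
   2^-1 * (sqnorm (tsub x g) + sqnorm (tsub x b)) - sqnorm (tsub x a).
  rewrite /sqnorm -big_split/= mulr_sumr -sumrB; apply: eq_bigr => j _.
  by rewrite !tnth_mktuple gE; field.
rewrite expr_div_n -mulr_natl; field.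
by rewrite gt_eqF.
Qed.

End gaussian_comparison.

(** * A quadratic inequality as a family of linear ones *)

Section affine_minorants.
Context {R : realType}.

(** The quadratic [c - 2 * lam * a + lam ^+ 2 * b] is least at [lam = a / b], with value
    [c - a ^+ 2 / b]. *)
Lemma sqr_le_of_affine_bounds (a b c : R) : 0 < a -> 0 < b ->
  (forall lam, 0 < lam -> 2 * lam * a <= c + lam ^+ 2 * b) -> a ^+ 2 <= c * b.
Proof.
move=> a0 b0 /(_ (a / b)); rewrite divr_gt0// => /(_ isT).
rewrite (_ : 2 * _ * a = 2 * (a ^+ 2 / b)); last by field; rewrite gt_eqF.
rewrite (_ : _ ^+ 2 * b = a ^+ 2 / b); last by field; rewrite gt_eqF.
by move=> H; rewrite -ler_pdivrMr//; lra.
Qed.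

(** The converse direction, by completing the square. For fixed [lam] the bound is linear in [a],
    [b], [c] and can therefore be integrated. *)
Lemma affine_bound_of_sqr_le (a b c lam : R) : 0 < b -> a ^+ 2 <= c * b ->
  2 * lam * a <= c + lam ^+ 2 * b.
Proof.
move=> b0 H; rewrite -(ler_pM2r b0) -subr_ge0.
rewrite (_ : _ - _ = (c * b - a ^+ 2) + (a - lam * b) ^+ 2); last by ring.
by rewrite addr_ge0 ?sqr_ge0// subr_ge0.
Qed.

End affine_minorants.

(** * Brackets and a quadratic bound for mixtures *)

Section mixture_comparison.
Context {R : realType} {d D : nat} {Z : set (d.-tuple R)}.
Context {PZ : probability (d.-tuple R) R}.
Hypotheses (mZ : measurable Z) (PZ1 : PZ Z = 1%E).
Implicit Types (f : d.-tuple R -> D.-tuple R) (s : R).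

(** The lower bound on [s' / s] makes [r ^+ 2 - 1] at least [2 * rho], so the shift costs at most
    [rho] in the exponent per coordinate; the upper bound gives [r <= exp (2 * rho)]. Together they
    cost [3 * rho] per coordinate. *)
Lemma pdens_bracket (rho smin s s' : R) f (c : d.-tuple R -> D.-tuple R) x :
  0 < rho -> 0 < smin -> smin <= s ->
  (1 + rho) * s <= s' <= (1 + rho) ^+ 2 * s ->
  measurable_fun Z f -> measurable_fun Z c ->
  (forall z j, Z z -> `|tnth (f z) j - tnth (c z) j| <= rho * smin) ->
  pdens Z PZ f s x <= expR (3 * rho * D%:R) * pdens Z PZ c s' x.
Proof.
move=> rho0 smin0 smins /andP[s'l s'u] mf mc fc.
have s0 : 0 < s by exact: lt_le_trans smins.
have s'0 : 0 < s' by apply: lt_le_trans s'l; rewrite mulr_gt0// addr_gt0.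
pose r := s' / s.
have rs : r * s = s' by rewrite divfK ?gt_eqF.
have r1 : 1 + rho <= r by rewrite ler_pdivlMr.
have r2 : r <= (1 + rho) ^+ 2 by rewrite ler_pdivrMr.
have r0 : 0 < r by rewrite divr_gt0.
have := @pdens_le_lin R d D Z PZ mZ PZ1 1 (expR (3 * rho * D%:R)) 0 s s' s'
  f c c x ler01 (expR_ge0 _) (lexx _) s0 s'0 s'0 mf mc mc.
rewrite mul1r mul0r addr0; apply => z Zz; rewrite mul1r mul0r addr0.
apply: (le_trans (@phi_scale R D s r (rho * smin) x (f z) (c z) s0 _ _)).
- by apply: lt_le_trans r1; rewrite ltrDl.
- by move=> j; exact: fc.
rewrite rs; apply: ler_wpM2r; first by rewrite ltW// phi_gt0.
rewrite [3 * _ * _]mulrC expRM_natl lerXn2r ?nnegrE ?expR_ge0//.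
  by rewrite mulr_ge0 ?expR_ge0// ltW.
have -> : 3 * rho = rho *+ 2 + rho by rewrite -mulr_natl; ring.
rewrite expRD; apply: ler_pM => //; rewrite ?expR_ge0 ?(ltW r0)//.
  rewrite (le_trans r2)// -mulr_natl expRM_natl lerXn2r ?nnegrE ?expR_ge0//.
    by rewrite addr_ge0// ltW.
  exact: expR_ge1Dx.
rewrite ler_expR.
have rr : 2 * rho <= r ^+ 2 - 1.
  rewrite lerBrDl (le_trans _ (_ : (1 + rho) ^+ 2 <= _))//.
    by rewrite sqrrD expr1n mul1r; nra.
  by rewrite lerXn2r ?nnegrE// ?ltW// addr_gt0.
have rr0 : 0 < r ^+ 2 - 1 by apply: lt_le_trans rr; rewrite mulr_gt0.
rewrite ler_pdivrMr ?mulr_gt0 ?exprn_gt0//.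
have H : rho * (2 * s ^+ 2 * (2 * rho)) <= rho * (2 * s ^+ 2 * (r ^+ 2 - 1)).
  by rewrite ler_pM2l// ler_pM2l// mulr_gt0// exprn_gt0.
apply: le_trans H.
have H2 : smin ^+ 2 <= s ^+ 2 by rewrite lerXn2r ?nnegrE// ltW.
rewrite exprMn; have := sqr_ge0 rho; nra.
Qed.

(* Convexity of [(p, q) |-> p^2 / q]: the affine minorant with slope
   [lambda = p_a / p_b] is integrated over the mixing variable. *)
Lemma pdens_sqr_le s (del : R) (a b : d.-tuple R -> D.-tuple R) : 0 < s ->
  measurable_fun Z a -> measurable_fun Z b ->
  (forall z j, Z z -> `|tnth (b z) j - tnth (a z) j| <= del) ->
  exists2 g, measurable_fun Z g & forall x,
   pdens Z PZ a s x ^+ 2 <=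
   expR (D%:R * (del / s) ^+ 2) * pdens Z PZ g s x * pdens Z PZ b s x.
Proof.
move=> s0 ma mb ab.
(* [G] reflects [p.2] in [p.1]. Being measurable on all pairs, it yields a measurable mean [2a - b]
   when composed with the extensions of [a] and [b]. *)
pose G (p : D.-tuple R * D.-tuple R) : D.-tuple R :=
  [tuple 2 * tnth p.1 j - tnth p.2 j | j < D].
have mG : measurable_fun setT G.
  apply/measurable_fun_tnthP => j.
  rewrite (_ : _ \o _ = fun p : D.-tuple R * D.-tuple R => 2 * tnth p.1 j - tnth p.2 j); last first.
    by apply/funext => p /=; rewrite tnth_mktuple.
  apply: measurable_funB.
    apply: measurable_funM; first exact: measurable_cst.
    exact: (measurableT_comp (measurable_tnth j) measurable_fst).
  exact: (measurableT_comp (measurable_tnth j) measurable_snd).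
pose g z := G (@zext R d D Z a z, @zext R d D Z b z).
have gE z j : Z z -> tnth (g z) j = 2 * tnth (a z) j - tnth (b z) j.
  by move=> Zz; rewrite tnth_mktuple /= /zext mem_set.
have mg : measurable_fun Z g.
  apply: measurable_funTS; apply: (measurableT_comp mG).
  by apply: measurable_fun_pair; exact: measurable_zext.
move: g gE mg => g gE mg.
exists g; first exact: mg.
move=> x.
apply: sqr_le_of_affine_bounds.
- exact: (pdens_gt0 mZ PZ1 x s0 ma).
- exact: (pdens_gt0 mZ PZ1 x s0 mb).
move=> lam lam0; apply: (pdens_le_lin mZ PZ1 _ (expR_ge0 _) (sqr_ge0 _) s0 s0 s0 ma mg mb).
  by rewrite mulr_ge0// ltW.
move=> z Zz; apply: affine_bound_of_sqr_le; first exact: phi_gt0.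
apply: phi_sqr_le => // j; first exact: ab.
exact: gE.
Qed.

End mixture_comparison.

(** * Hellinger distance and affinity *)

Section hellinger_theory.
Context {R : realType} {D : nat}.

(** Strict positivity is included so that logarithms and likelihood ratios are meaningful at every
    point. *)
Definition density (p : D.-tuple R -> R) :=
  [/\ measurable_fun setT p, forall x, 0 < p x &
      lebint (fun x => (p x)%:E) = 1%E].

Implicit Types p q r : D.-tuple R -> R.

Lemma measurable_sqrtr p : measurable_fun setT p ->
  measurable_fun setT (fun x => Num.sqrt (p x)).
Proof.
have ms : measurable_fun setT (@Num.sqrt R).
  by apply: continuous_measurable_fun; exact: sqrt_continuous.
by move=> mp; exact: (measurableT_comp ms mp).
Qed.

Lemma integral_density p : density p -> (\int[lebm D]_x (p x)%:E = 1)%E.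
Proof.
move=> [mp p0 <-]; rewrite lebintE//; first exact/measurable_EFinP.
by move=> x; rewrite lee_fin ltW.
Qed.

Lemma hellinger_affinity p q : density p -> density q ->
  (\int[lebm D]_x ((Num.sqrt (p x) - Num.sqrt (q x)) ^+ 2)%:E =
    (hellinger p q ^+ 2)%:E /\
   \int[lebm D]_x (Num.sqrt (p x * q x))%:E = (1 - hellinger p q ^+ 2 / 2)%:E)%E.
Proof.
move=> dp dq; have [mp p0 _] := dp; have [mq q0 _] := dq.
have mpq : measurable_fun setT (fun x => Num.sqrt (p x * q x)).
  by apply: measurable_sqrtr; exact: measurable_funM.
have mh : measurable_fun setT (fun x => (Num.sqrt (p x) - Num.sqrt (q x)) ^+ 2).
  by apply: measurable_funX; apply: measurable_funB; exact: measurable_sqrtr.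
set I1 := integral _ _ _; set I2 := integral _ _ _.
have I10 : (0 <= I1)%E by apply: integral_ge0 => x _; rewrite lee_fin sqr_ge0.
have I20 : (0 <= I2)%E by apply: integral_ge0 => x _; rewrite lee_fin sqrtr_ge0.
have I12 : (I1 + 2%:E * I2 = 2%:E)%E.
  have mpqE : measurable_fun setT (fun x => (Num.sqrt (p x * q x))%:E).
    exact/measurable_EFinP.
  have mhE : measurable_fun setT
      (fun x => ((Num.sqrt (p x) - Num.sqrt (q x)) ^+ 2)%:E).
    exact/measurable_EFinP.
  have mpq2 : measurable_fun setT (fun x => (2%:E * (Num.sqrt (p x * q x))%:E)%E).
    by apply: emeasurable_funM => //; exact: measurable_cst.
  have pq0 x : [set: D.-tuple R] x -> (0 <= (Num.sqrt (p x * q x))%:E)%E.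
    by move=> _; rewrite lee_fin sqrtr_ge0.
  have pq20 x : [set: D.-tuple R] x -> (0 <= 2%:E * (Num.sqrt (p x * q x))%:E)%E.
    by move=> _; rewrite -EFinM lee_fin mulr_ge0// sqrtr_ge0.
  have h0 x : [set: D.-tuple R] x ->
      (0 <= ((Num.sqrt (p x) - Num.sqrt (q x)) ^+ 2)%:E)%E.
    by move=> _; rewrite lee_fin sqr_ge0.
  rewrite -ge0_integralZl_EFin// -ge0_integralD//.
  transitivity (\int[lebm D]_x ((p x)%:E + (q x)%:E))%E.
    apply: eq_integral => x _; rewrite -EFinM -!EFinD; congr EFin.
    rewrite sqrtrM ?(ltW (p0 x))//.
    rewrite -[in RHS](sqr_sqrtr (ltW (p0 x))) -[in RHS](sqr_sqrtr (ltW (q0 x))).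
    by ring.
  rewrite ge0_integralD//.
  - by rewrite !integral_density// -EFinD.
  - by move=> x _; rewrite lee_fin ltW.
  - exact/measurable_EFinP.
  - by move=> x _; rewrite lee_fin ltW.
  - exact/measurable_EFinP.
have hE : hellinger p q = Num.sqrt (fine I1).
  rewrite /hellinger lebintE//; first exact/measurable_EFinP.
  by move=> x; rewrite lee_fin sqr_ge0.
have I1f : I1 \is a fin_num.
  rewrite ge0_fin_numE// (@le_lt_trans _ _ 2%:E) ?ltry// -I12 leeDl//.
  by rewrite mule_ge0.
have I2f : I2 \is a fin_num.
  rewrite ge0_fin_numE// (@le_lt_trans _ _ 2%:E) ?ltry//.
  rewrite -I12 -[leLHS]mul1e -[leLHS]add0e leeD// lee_wpmul2r// lee_fin; lra.
rewrite hE sqr_sqrtr ?fine_ge0//; split; first by rewrite fineK.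
move: I12; rewrite -(fineK I1f) -(fineK I2f) /= -EFinM -EFinD => -[] H.
by congr EFin; lra.
Qed.

(** Since [q >= exp (- m) * p], the affinity is at least [exp (- m / 2)], hence at least
    [1 - m / 2]. *)
Lemma hellinger_bracket p q (m : R) : density p -> density q ->
  (forall x, p x <= expR m * q x) -> hellinger p q ^+ 2 <= m.
Proof.
move=> dp dq pq; have [_ aff] := hellinger_affinity dp dq.
have [mp p0 _] := dp; have [mq q0 _] := dq.
have : ((expR (- (m / 2)))%:E <= (1 - hellinger p q ^+ 2 / 2)%:E)%E.
  rewrite -aff -[leLHS]mule1 -(integral_density dp).
  rewrite -ge0_integralZl_EFin ?expR_ge0//; last 2 first.
  - by move=> x _; rewrite lee_fin ltW.
  - exact/measurable_EFinP.
  apply: ge0_le_integral => //.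
  - by move=> x _; rewrite -EFinM lee_fin mulr_ge0 ?expR_ge0// ltW.
  - apply: emeasurable_funM; first exact: measurable_cst.
    exact/measurable_EFinP.
  - by apply/measurable_EFinP; apply: measurable_sqrtr; exact: measurable_funM.
  - move=> x _; rewrite -EFinM lee_fin.
    have pe0 : 0 <= expR (- (m / 2)) * p x by rewrite mulr_ge0 ?expR_ge0// ltW.
    rewrite -[leLHS](ger0_norm pe0) -sqrtr_sqr ler_wsqrtr//.
    rewrite exprMn -expRM_natl (_ : 2 * - (m / 2) = - m); last by field.
    by rewrite expRN expr2 mulrCA ler_pM2l// ler_pdivrMl ?expR_gt0.
rewrite lee_fin => H; have := expR_ge1Dx (- (m / 2)); lra.
Qed.

(** Integrates the pointwise inequality [(u + v) ^+ 2 <= 2 * u ^+ 2 + 2 * v ^+ 2]. *)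
Lemma hellinger_sqr_triangle p q r : density p -> density q -> density r ->
  hellinger p r ^+ 2 <= 2 * hellinger p q ^+ 2 + 2 * hellinger q r ^+ 2.
Proof.
move=> dp dq dr; rewrite -lee_fin EFinD !(EFinM 2).
rewrite -(hellinger_affinity dp dr).1 -(hellinger_affinity dp dq).1.
rewrite -(hellinger_affinity dq dr).1.
have mh p' q' : density p' -> density q' -> measurable_fun setT
    (fun x => ((Num.sqrt (p' x) - Num.sqrt (q' x)) ^+ 2)%:E).
  move=> [mp _ _] [mq _ _]; apply/measurable_EFinP.
  by apply: measurable_funX; apply: measurable_funB; exact: measurable_sqrtr.
have h0 p' q' (c : R) x : 0 <= c ->
    (0 <= c%:E * ((Num.sqrt (p' x) - Num.sqrt (q' x)) ^+ 2)%:E)%E.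
  by move=> c0; rewrite -EFinM lee_fin mulr_ge0// sqr_ge0.
have mh2 p' q' (c : R) : density p' -> density q' -> measurable_fun setT
    (fun x => c%:E * ((Num.sqrt (p' x) - Num.sqrt (q' x)) ^+ 2)%:E)%E.
  by move=> *; apply: emeasurable_funM; [exact: measurable_cst|exact: mh].
rewrite -!ge0_integralZl_EFin//; try exact: mh;
  try by move=> x _; rewrite lee_fin sqr_ge0.
rewrite -ge0_integralD//; try exact: mh2; try by move=> x _; exact: h0.
apply: ge0_le_integral => //.
- by move=> x _; rewrite lee_fin sqr_ge0.
- exact: mh.
- by apply: emeasurable_funD; exact: mh2.
- move=> x _; rewrite -!EFinM -EFinD lee_fin.
  have := sqr_ge0 ((Num.sqrt (p x) - Num.sqrt (q x)) - (Num.sqrt (q x) - Num.sqrt (r x))).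
  by nra.
Qed.

(** As [p] is within squared distance [m] of [q], the triangle inequality gives
    [hellinger q r ^+ 2 >= eps ^+ 2 / 2 - m]; then [1 + x <= exp x]. *)
Lemma affinity_le_bracket p q r (m eps : R) :
  density p -> density q -> density r -> 0 <= eps ->
  (forall x, p x <= expR m * q x) -> eps < hellinger p r ->
  (\int[lebm D]_x (Num.sqrt (q x * r x))%:E <= (expR (m / 2 - eps ^+ 2 / 4))%:E)%E.
Proof.
move=> dp dq dr eps0 pq epsh; rewrite (hellinger_affinity dq dr).2 lee_fin.
apply: le_trans (expR_ge1Dx _).
have h1 := hellinger_bracket dp dq pq.
have h2 := hellinger_sqr_triangle dp dq dr.
have h3 : eps ^+ 2 <= hellinger p r ^+ 2.
  by rewrite lerXn2r ?nnegrE// ?ltW// (le_lt_trans eps0).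
by lra.
Qed.

End hellinger_theory.

(** * Exponential deviation bounds for sums over the sample *)

Section likelihood_deviation.
Context {R : realType} {D n : nat} {d} {T : measurableType d}.
Context (P : probability T R) (X : 'I_n -> T -> D.-tuple R) (p : D.-tuple R -> R).
Hypothesis mX : forall i, measurable_fun setT (X i).
Hypothesis indep : forall B : 'I_n -> set (D.-tuple R), (forall i, measurable (B i)) ->
  P (\bigcap_(i in [set: 'I_n]) (X i @^-1` B i))
    = (\prod_(i < n) P (X i @^-1` B i))%E.
Hypothesis dp : density p.
Hypothesis lawX : forall i B, measurable B ->
  P (X i @^-1` B) = lebint (fun x => ((\1_B x : R) * p x)%:E).

(** The law is given on sets; it extends to functions with weight one under [P] and weight [p] under
    [lebm D]. *)
Lemma integral_law i (g : D.-tuple R -> R) : measurable_fun setT g ->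
  (forall x, 0 <= g x) ->
  (\int[P]_w (g (X i w))%:E = \int[lebm D]_x (p x * g x)%:E)%E.
Proof.
move=> mg g0; have [mp p0 _] := dp.
have := @ge0_integral_weight_ext R _ _ P _ _ (lebm D) _ _ (cst 1) p (X i) id.
move=> /(_ _ _ _ _ _ _ _ (EFin \o g)) H.
transitivity (\int[P]_w ((cst 1 w)%:E * (EFin \o g) (X i w)))%E.
  by apply: eq_integral => w _; rewrite mul1e.
rewrite H//=.
- by move=> x; rewrite ltW.
- move=> B mB; under eq_integral do rewrite mul1r.
  rewrite -[LHS]/(\int[P]_w (\1_(X i @^-1` B) w)%:E)%E integral_indic//; last first.
    by rewrite -[X in measurable X]setTI; exact: mX.
  rewrite setIT [LHS]lawX// lebintE.
  + by apply: eq_integral => x _; rewrite mulrC.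
  + by apply/measurable_EFinP; apply: measurable_funM => //; exact: measurable_indic.
  + by move=> x; rewrite lee_fin mulr_ge0// ltW.
- exact/measurable_EFinP.
Qed.

(** Markov's inequality for the exponential of the sum, whose mean is an [n]-th power by
    independence. *)
Lemma chernoff_iid (ell : D.-tuple R -> R) (a t : R) : measurable_fun setT ell ->
  (\int[lebm D]_x (p x * expR (ell x))%:E <= (expR a)%:E)%E ->
  measurable [set w | t <= \sum_(i < n) ell (X i w)] /\
  (P [set w | (t <= \sum_(i < n) ell (X i w))%R] <= (expR (n%:R * a - t))%:E)%E.
Proof.
move=> mell int_le; have [mp p0 _] := dp.
have mg : measurable_fun setT (expR \o ell) by exact: measurableT_comp.
pose e := fine (\int[lebm D]_x (p x * expR (ell x))%:E)%E.
have int0 : (0 <= \int[lebm D]_x (p x * expR (ell x))%:E)%E.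
  by apply: integral_ge0 => x _; rewrite lee_fin mulr_ge0 ?expR_ge0// ltW.
have eE : (\int[lebm D]_x (p x * expR (ell x))%:E = e%:E)%E.
  by rewrite fineK// ge0_fin_numE// (le_lt_trans int_le)// ltry.
have ea : e <= expR a by rewrite -lee_fin -eE.
have e0 : 0 <= e by rewrite -lee_fin -eE.
pose S w := \sum_(i < n) ell (X i w).
have mS : measurable_fun setT S.
  by apply: measurable_sum => i; exact: (measurableT_comp mell (mX i)).
have mE : measurable [set w | t <= S w].
  rewrite -[X in measurable X]setTI.
  by have := @measurable_fun_ler _ _ _ setT (cst t) S (measurable_cst _) mS measurableT [set true] Logic.I.
split=> //.
have mexpS : measurable_fun setT (fun w => (expR (S w))%:E).
  by apply/measurable_EFinP; exact: measurableT_comp.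
have intS : (\int[P]_w (expR (S w))%:E = (e ^+ n)%:E)%E.
  transitivity (\int[P]_w (\prod_(i < n) (expR \o ell) (X i w))%:E)%E.
    by apply: eq_integral => w _; rewrite /S expR_sum.
  rewrite (integral_prod_indep mX indep (g := fun=> expR \o ell) (e := fun=> e))//.
  - by rewrite prodr_const card_ord.
  - by move=> i x; exact: expR_ge0.
  - move=> i; rewrite (integral_law i mg)// => x; exact: expR_ge0.
have := @le_integral_abse _ _ _ P setT measurableT _ (expR t) mexpS (expR_gt0 t).
under eq_integral do rewrite gee0_abs ?lee_fin ?expR_ge0//.
rewrite intS setTI (_ : [set x | _] = [set w | t <= S w]); last first.
  apply/seteqP; split => w /=.
    by rewrite ger0_norm ?expR_ge0// lee_fin ler_expR.
  by rewrite ger0_norm ?expR_ge0// lee_fin ler_expR.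
move=> H.
rewrite expRD expRN expRM_natl mulrC EFinM -lee_pdivrMl ?invr_gt0 ?expR_gt0//.
rewrite invrK (le_trans H)// lee_fin lerXn2r ?nnegrE ?expR_ge0//.
Qed.

End likelihood_deviation.

(** * Approximate maximum likelihood over a model with finitely many brackets *)

Section approximate_mle.
Context {R : realType} {D n : nat} {d} {T : measurableType d}.
Context (P : probability T R) (X : 'I_n -> T -> D.-tuple R) (p : D.-tuple R -> R).
Hypothesis mX : forall i, measurable_fun setT (X i).
Hypothesis indep : forall B : 'I_n -> set (D.-tuple R), (forall i, measurable (B i)) ->
  P (\bigcap_(i in [set: 'I_n]) (X i @^-1` B i))
    = (\prod_(i < n) P (X i @^-1` B i))%E.
Hypothesis dp : density p.
Hypothesis lawX : forall i B, measurable B ->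
  P (X i @^-1` B) = lebint (fun x => ((\1_B x : R) * p x)%:E).

Lemma measure_bigsetU_le_card (I : Type) (s : seq I) (A : I -> set T) (c : R) :
  (forall i, measurable (A i) /\ (P (A i) <= c%:E)%E) ->
  measurable (\big[setU/set0]_(i <- s) A i) /\
  (P (\big[setU/set0]_(i <- s) A i) <= ((size s)%:R * c)%:E)%E.
Proof.
move=> Ac; elim: s => [|i s [mU PU]].
  by rewrite big_nil measure0 mul0r.
have [mi Pi] := Ac i.
rewrite big_cons; split; first exact: measurableU.
rewrite /= -[X in X * c]natr1 mulrDl mul1r addrC EFinD.
by apply: (le_trans (measureU2 _ _ _)) => //; exact: leeD.
Qed.

Lemma measurable_ln_density (q : D.-tuple R -> R) : density q ->
  measurable_fun setT (fun x => ln (q x)).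
Proof.
by move=> [mq _ _]; exact: (measurableT_comp (@measurable_ln R) mq).
Qed.

(* Off the exceptional set, every bracket far from [p] has log-likelihood below
   that of [p] by [n eps^2 / 3], while [p0] loses at most [n eps^2 / 6]. *)
Lemma approximate_mle_deviation (I : finType) (q : I -> D.-tuple R -> R)
    (p0 : D.-tuple R -> R) (phat : T -> D.-tuple R -> R) (m eps eta a0 : R) :
  (forall i, density (q i)) -> density p0 -> (forall w, density (phat w)) ->
  0 <= eps ->
  (\int[lebm D]_x (p x * expR (ln (p x) - ln (p0 x)))%:E <= (expR a0)%:E)%E ->
  (forall w, exists i, forall x, phat w x <= expR m * q i x) ->
  (forall w, \sum_(i < n) ln (p0 (X i w)) - eta <= \sum_(i < n) ln (phat w (X i w))) ->
  eta <= n%:R * (eps ^+ 2 / 6) ->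
  exists E : set T, [/\ measurable E,
    [set w | eps < hellinger (phat w) p] `<=` E &
    (P E <= (#|I|%:R * expR (n%:R * (m - eps ^+ 2 / 12)) +
             expR (n%:R * (a0 - eps ^+ 2 / 6)))%:E)%E].
Proof.
move=> dq dp0 dphat eps0 inta0 brk mle etale.
have [mp pp _] := dp.
have mlnp := measurable_ln_density dp.
pose ell0 x := ln (p x) - ln (p0 x).
have mell0 : measurable_fun setT ell0.
  by apply: measurable_funB => //; exact: measurable_ln_density.
pose t0 : R := n%:R * (eps ^+ 2 / 6).
have [mE0 PE0] := @chernoff_iid R D n _ T P X p mX indep dp lawX ell0 a0 t0 mell0 inta0.
(* The factor one half turns [p * exp (ell i)] into [sqrt (q i * p)], whose integral is the
   affinity. *)
pose ell i x := 2^-1 * (ln (q i x) - ln (p x)).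
have mell i : measurable_fun setT (ell i).
  apply: measurable_funM; first exact: measurable_cst.
  by apply: measurable_funB => //; exact: measurable_ln_density.
(* Half of the deficit [n * (m + eps ^+ 2 / 3)] allowed to a bracket: [m] is the bracket's width,
   and the approximant and [eta] contribute [eps ^+ 2 / 6] each. *)
pose t1 : R := - (n%:R * (eps ^+ 2 / 6 + m / 2)).
(* Brackets are selected by the affinity bound itself; the others get the empty event, so the union
   may run over all of [I]. *)
pose far i := `[< (\int[lebm D]_x (p x * expR (ell i x))%:E <=
                   (expR (m / 2 - eps ^+ 2 / 4))%:E)%E >].
pose A i := if far i then [set w | t1 <= \sum_(j < n) ell i (X j w)] else set0.
have HA i : measurable (A i) /\ (P (A i) <= (expR (n%:R * (m - eps ^+ 2 / 12)))%:E)%E.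
  rewrite /A; case: ifPn => [/asboolP fari|_]; last by rewrite measure0 lee_fin expR_ge0.
  have [mA PA] := @chernoff_iid R D n _ T P X p mX indep dp lawX (ell i) _ t1 (mell i) fari.
  split=> //; apply: (le_trans PA); rewrite lee_fin ler_expR /t1.
  by rewrite le_eqVlt; apply/orP; left; apply/eqP; field.
have [mU PU] := measure_bigsetU_le_card (enum I) HA.
exists (\big[setU/set0]_(i <- enum I) A i `|` [set w | t0 <= \sum_(j < n) ell0 (X j w)]).
split; first exact: measurableU.
- move=> w /= far_w.
  have [i Hi] := brk w.
  have fari : far i.
    apply/asboolP.
    have := affinity_le_bracket (dphat w) (dq i) dp eps0 Hi far_w.
    apply: le_trans; rewrite le_eqVlt; apply/orP; left; apply/eqP.
    apply: eq_integral => x _; congr EFin.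
    have [_ qi0 _] := dq i.
    have qp : 0 < q i x * p x by rewrite mulr_gt0.
    rewrite -[LHS]ger0_norm ?mulr_ge0 ?expR_ge0 ?(ltW (pp x))// -sqrtr_sqr.
    congr Num.sqrt; rewrite exprMn -expRM_natl mulrA divff// mul1r expRD expRN.
    by rewrite !lnK ?posrE// expr2 mulrC; field; rewrite gt_eqF.
  have [t0w|w0] := leP t0 (\sum_(j < n) ell0 (X j w)); first by right.
  left; rewrite -bigcup_seq; exists i; first by rewrite /= mem_enum.
  (* Outside both events, [phat w] would fall short of [p0] by more than [eta]. *)
  rewrite /A fari /= leNgt; apply/negP => w1.
  have := mle w; apply/negP; rewrite -ltNge.
  have le1 : \sum_(j < n) ln (phat w (X j w)) <= \sum_(j < n) (m + ln (q i (X j w))).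
    apply: ler_sum => j _; have [_ qi0 _] := dq i; have [_ ph0 _] := dphat w.
    rewrite -[X in X + _]expRK -lnM ?posrE ?expR_gt0//.
    by rewrite ler_ln ?posrE ?mulr_gt0 ?expR_gt0.
  apply: (le_lt_trans le1).
  rewrite big_split/= sumr_const card_ord -mulr_natl.
  move: w0 w1; rewrite /ell0 /ell -mulr_sumr !sumrB /t0 /t1; lra.
- apply: (le_trans (measureU2 _ _ _)) => //; rewrite EFinD; apply: leeD.
    by move: PU; rewrite -cardE.
  apply: (le_trans PE0); rewrite lee_fin ler_expR /t0.
  by rewrite le_eqVlt; apply/orP; left; apply/eqP; ring.
Qed.

End approximate_mle.

(** * Finite covers with centers in the class *)

Section covering.
Context {R : realType} {d D : nat} (Z : set (d.-tuple R)).
Implicit Types f g : d.-tuple R -> D.-tuple R.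

Lemma supdist_le f g (del : R) : (supdist Z f g <= del%:E)%E ->
  forall z j, Z z -> `|tnth (f z) j - tnth (g z) j| <= del.
Proof.
move=> fg z j Zz; rewrite -lee_fin; apply: le_trans fg.
by apply: ereal_sup_ubound; exists z => //; exists j.
Qed.

(* The centers of a cover need not lie in [F]; moving them into [F] doubles the radius. *)
Lemma covering_centers (F : set (d.-tuple R -> D.-tuple R)) (del B : R) :
  (exists f, F f) -> (covering_number Z F del <= B%:E)%E ->
  exists N (c : 'I_N -> d.-tuple R -> D.-tuple R),
  [/\ N%:R <= B + 1, forall i, F (c i) & forall f, F f ->
      exists i, forall z j, Z z -> `|tnth (f z) j - tnth (c i z) j| <= 2 * del].
Proof.
move=> [f0 Ff0] covB.
(* A slack of one turns the bound on the infimum into an actual cover. *)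
have /ereal_inf_lt[_ [N [c cov] <-] NB] : (covering_number Z F del < (B + 1)%:E)%E.
  by apply: (le_lt_trans covB); rewrite lte_fin ltrDl.
(* A ball that meets [F] gets a member of [F] as its new center; any other ball gets the default
   [f0]. *)
have /choice[c' Hc'] : forall i, exists f, F f /\
    ((exists2 g, F g & (supdist Z g (c i) <= del%:E)%E) ->
     (supdist Z f (c i) <= del%:E)%E).
  move=> i; have [[g Fg gi]|ng] :=
    pselect (exists2 g, F g & (supdist Z g (c i) <= del%:E)%E).
    by exists g.
  by exists f0.
exists N, c'; split.
- by rewrite -lee_fin ltW.
- by move=> i; have [] := Hc' i.
- move=> f Ff; have [i fi] := cov f Ff; exists i => z j Zz.
  have [_ /(_ (ex_intro2 _ _ f Ff fi)) c'i] := Hc' i.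
  have h1 := supdist_le fi j Zz; have h2 := supdist_le c'i j Zz.
  rewrite (le_trans (ler_distD (tnth (c i z) j) _ _))// mulr2n mulrDl mul1r lerD//.
  by rewrite distrC.
Qed.

End covering.

(** * An arithmetic grid of scales *)

Section scale_grid.
Context {R : realType}.

(** [k] is the integer part of [(s - smin) / (smin * rho)]. The grid point [t] below [s] satisfies
    [s <= t + smin * rho <= (1 + rho) * t], and the factor [(1 + rho) ^+ 2] then lifts it above [s]
    with room to spare. *)
Lemma scale_grid (rho smin smax s : R) : 0 < rho -> 0 < smin -> smin <= s <= smax ->
  exists k : 'I_(Num.truncn (smax / (smin * rho))).+1,
  let s' := (1 + rho) ^+ 2 * (smin * (1 + rho * k%:R)) in
  (1 + rho) * s <= s' <= (1 + rho) ^+ 2 * s.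
Proof.
move=> rho0 smin0 /andP[ls su].
have sr0 : 0 < smin * rho by rewrite mulr_gt0.
pose y := (s - smin) / (smin * rho).
have y0 : 0 <= y by rewrite divr_ge0 ?subr_ge0// ltW.
have /andP[ky yk] := truncn_itv y0.
have sE : s = smin + y * (smin * rho) by rewrite /y divfK ?gt_eqF// addrC subrK.
have smax0 : 0 <= smax / (smin * rho).
  by rewrite divr_ge0// ?(ltW sr0)// (le_trans _ su)// (le_trans _ ls)// ltW.
have /andP[_ maxk] := truncn_itv smax0.
have kG : (Num.truncn y < (Num.truncn (smax / (smin * rho))).+1)%N.
  rewrite -(ltr_nat R) (le_lt_trans ky)// (le_lt_trans _ maxk)//.
  by rewrite ler_pM2r ?invr_gt0// lerBlDr (le_trans su)// lerDl ltW.
exists (Ordinal kG) => /=.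
set k := (Num.truncn y)%:R; have k0 : 0 <= k by rewrite /k.
have ky' : k * (smin * rho) <= y * (smin * rho) by rewrite ler_pM2r.
have yk' : y * (smin * rho) <= (k + 1) * (smin * rho).
  by rewrite ler_pM2r// natr1 ltW.
have r10 : 0 < 1 + rho by rewrite addr_gt0.
have kr0 : 0 <= k * (smin * rho) by rewrite mulr_ge0// ltW.
have krr0 : 0 <= k * (smin * rho) * rho by rewrite mulr_ge0// ltW.
apply/andP; split; last first.
  rewrite ler_pM2l ?exprn_gt0// sE mulrDr mulr1 lerD2l.
  by rewrite (_ : smin * (rho * k) = k * (smin * rho))//; ring.
rewrite expr2 -mulrA ler_pM2l// sE.
rewrite (_ : (1 + rho) * (smin * (1 + rho * k)) =
  smin + (k + 1) * (smin * rho) + k * (smin * rho) * rho); last by ring.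
by rewrite -addrA lerD2l (le_trans yk')// lerDl.
Qed.

End scale_grid.

(** * Counting the brackets *)

Section bracketing_number.
Context {R : realType}.

(** The cover contributes [exp (1 + s * (A + 1 + L))] and the grid [exp (smax + L)], where
    [L = ln (n / smin)]. As [s] and [A] are at least 1, each extra term is absorbed by a multiple of
    [B]. *)
Lemma bracketing_number_le (n N : nat) (smin smax s A : R) :
  (0 < n)%N -> 0 < smin -> smin <= 1 -> 0 < smax -> 1 <= s -> 1 <= A ->
  let B := s * (A + ln (n%:R / smin)) in
  N%:R <= expR (s * (A + Num.max 1 (ln (smin * n%:R^-1 / 2)^-1))) + 1 ->
  N%:R * (Num.truncn (smax / (smin * n%:R^-1))).+1%:R <= expR ((4 + smax) * B) /\
  1 <= B.
Proof.
move=> n0 smin0 smin1 smax0 s1 A1 B.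
set L := ln _ in B *.
have nR : 0 < n%:R :> R by rewrite ltr0n.
have n1 : 1 <= n%:R :> R by rewrite ler1n.
have u1 : 1 <= n%:R / smin by rewrite ler_pdivlMr// mul1r (le_trans smin1).
have u0 : 0 < n%:R / smin by rewrite divr_gt0.
have L0 : 0 <= L by exact: ln_ge0.
have s0 : 0 <= s by exact: le_trans s1.
have sA : s <= s * A by rewrite ler_peMr.
have sL : 0 <= s * L by rewrite mulr_ge0.
have LsL : L <= s * L by rewrite ler_peMl.
have BE : B = s * A + s * L by rewrite /B mulrDr.
have B1 : 1 <= B by rewrite BE; lra.
have smaxB : smax <= smax * B by rewrite ler_peMr// ltW.
have two : 2 <= expR 1 :> R by have := expR_ge1Dx (1 : R); lra.
(* The inverse radius is [2 * n / smin], and [ln 2 <= 1]. *)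
have maxL : Num.max 1 (ln (smin * n%:R^-1 / 2)^-1) <= 1 + L.
  rewrite ge_max lerDl L0/=.
  rewrite (_ : _^-1 = 2 * (n%:R / smin)); last by field; rewrite !gt_eqF.
  rewrite lnM ?posrE// lerD2r.
  by rewrite -[X in ln X]natr1; apply: le_ln1Dx; lra.
move=> NB; split=> //.
have N' : N%:R <= expR (1 + s * (A + (1 + L))).
  rewrite (le_trans NB)// expRD.
  have e1 : 1 <= expR (s * (A + (1 + L))).
    by rewrite -[leLHS]expR0 ler_expR mulr_ge0// addr_ge0//; lra.
  have e2 : expR (s * (A + Num.max 1 (ln (smin * n%:R^-1 / 2)^-1)))
      <= expR (s * (A + (1 + L))) by rewrite ler_expR ler_wpM2l// lerD2l.
  have e3 : 2 * expR (s * (A + (1 + L))) <= expR 1 * expR (s * (A + (1 + L))).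
    by rewrite ler_wpM2r// expR_ge0.
  by lra.
have G' : (Num.truncn (smax / (smin * n%:R^-1))).+1%:R <= expR (smax + L).
  have v0 : 0 <= smax / (smin * n%:R^-1) by rewrite divr_ge0// ?mulr_ge0 ?ltW// invr_gt0.
  have /andP[tv _] := truncn_itv v0.
  rewrite -natr1 (le_trans (lerD tv (lexx 1)))//.
  rewrite (_ : smax / _ = smax * (n%:R / smin)); last by field; rewrite !gt_eqF.
  rewrite expRD lnK ?posrE//.
  apply: (@le_trans _ _ ((1 + smax) * (n%:R / smin))).
    by rewrite mulrDl mul1r addrC lerD2r.
  by rewrite ler_pM2r// expR_ge1Dx.
apply: (le_trans (ler_pM _ _ N' G')) => //.
by rewrite -expRD ler_expR mulrDl {1}BE; lra.
Qed.

End bracketing_number.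

(** * Densities of the model, the likelihood of the approximant, and the choice of constants *)

Lemma density_pdens (R : realType) (d D : nat) (Z : set (d.-tuple R))
    (PZ : probability (d.-tuple R) R) (f : d.-tuple R -> D.-tuple R) (s : R) :
  measurable Z -> PZ Z = 1%E -> 0 < s -> measurable_fun Z f ->
  density (pdens Z PZ f s).
Proof.
move=> mZ PZ1 s0 mf; split.
- exact: measurable_pdens.
- by move=> x; exact: pdens_gt0.
- exact: lebint_pdens.
Qed.

(* The chi-square divergence of the two mixtures is at most that of the shifted Gaussians. *)
Lemma integral_likelihood_ratio_le (R : realType) (d D : nat) (Z : set (d.-tuple R))
    (PZ : probability (d.-tuple R) R) (a b : d.-tuple R -> D.-tuple R) (s del : R) :
  measurable Z -> PZ Z = 1%E -> 0 < s -> measurable_fun Z a -> measurable_fun Z b ->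
  (forall z j, Z z -> `|tnth (b z) j - tnth (a z) j| <= del) ->
  (\int[lebm D]_x (pdens Z PZ a s x *
      expR (ln (pdens Z PZ a s x) - ln (pdens Z PZ b s x)))%:E
    <= (expR (D%:R * (del / s) ^+ 2))%:E)%E.
Proof.
move=> mZ PZ1 s0 ma mb ab.
have [g mg Hg] := pdens_sqr_le mZ PZ1 s0 ma mb ab.
have da := density_pdens mZ PZ1 s0 ma; have db := density_pdens mZ PZ1 s0 mb.
have dg := density_pdens mZ PZ1 s0 mg.
move: (pdens Z PZ a s) (pdens Z PZ b s) (pdens Z PZ g s) da db dg Hg.
move=> pa pb pg da db dg Hg.
have [mpa pa0 _] := da; have [mpb pb0 _] := db; have [mpg pg0 _] := dg.
rewrite -[leRHS]mule1 -(integral_density dg) -ge0_integralZl_EFin ?expR_ge0//; last 2 first.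
- by move=> x _; rewrite lee_fin ltW.
- exact/measurable_EFinP.
apply: ge0_le_integral => //.
- by move=> x _; rewrite lee_fin mulr_ge0 ?expR_ge0// ltW.
- apply/measurable_EFinP; apply: measurable_funM => //.
  apply: measurableT_comp => //.
  by apply: measurable_funB; exact: measurable_ln_density.
- apply: emeasurable_funM; first exact: measurable_cst.
  exact/measurable_EFinP.
- move=> x _; rewrite -EFinM lee_fin expRD expRN !lnK ?posrE//.
  by rewrite mulrA -expr2 ler_pdivrMr.
Qed.

Theorem theorem1 (R : realType) :
  exists C1 : R, 0 < C1 /\
  forall D : nat, (0 < D)%N ->
  exists C2 delta_star : R, 0 < delta_star /\
  forall K sigma_max : R, 0 < K -> 0 < sigma_max ->
  exists C3 : R, 0 < C3 /\
  forall (n d : nat) (Z : set (d.-tuple R)) (PZ : probability (d.-tuple R) R)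
    (sigma_min : R) (F : set (d.-tuple R -> D.-tuple R)) (s A : R)
    (fstar : d.-tuple R -> D.-tuple R) (sigma_star delta_app eta : R)
    (dO : measure_display) (Omega : measurableType dO) (P : probability Omega R)
    (X : 'I_n -> Omega -> D.-tuple R)
    (fhat : Omega -> d.-tuple R -> D.-tuple R) (sigmahat : Omega -> R),
  (0 < n)%N -> (0 < d)%N ->
  open_tuple_set Z ->
  PZ Z = 1%E ->
  0 < sigma_min -> sigma_min < sigma_max -> sigma_min <= 1 ->
  (forall f, F f -> measurable_fun Z f) ->
  (forall f, F f -> (supdist Z f (fun _ => [tuple (0%R : R) | _ < D]) <= K%:E)%E) ->
  1 <= s -> 1 <= A ->
  (forall delta : R, 0 < delta ->
     (covering_number Z F delta
       <= (expR (s * (A + Num.max 1 (ln (delta^-1)))))%:E)%E) ->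
  measurable_fun Z fstar ->
  sigma_min <= sigma_star <= sigma_max ->
  delta_app <= 1 ->
  (exists f, F f /\ (supdist Z f fstar <= delta_app%:E)%E) ->
  (* X_1, ..., X_n are measurable, mutually independent, with density p_* *)
  (forall i, measurable_fun setT (X i)) ->
  (forall B : 'I_n -> set (D.-tuple R), (forall i, measurable (B i)) ->
     P (\bigcap_(i in [set: 'I_n]) (X i @^-1` B i))
       = (\prod_(i < n) P (X i @^-1` B i))%E) ->
  (forall i (B : set (D.-tuple R)), measurable B ->
     P (X i @^-1` B)
       = lebint (fun x => ((\1_B x : R) * pdens Z PZ fstar sigma_star x)%:E)) ->
  (* (fhat, sigmahat) is an eta-approximate maximum likelihood estimator *)
  (forall w, F (fhat w) /\ sigma_min <= sigmahat w <= sigma_max) ->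
  (forall w, forall f sigma, F f -> sigma_min <= sigma <= sigma_max ->
     \sum_(i < n) ln (pdens Z PZ (fhat w) (sigmahat w) (X i w))
       >= \sum_(i < n) ln (pdens Z PZ f sigma (X i w)) - eta) ->
  let eps := C3 * Num.max (Num.sqrt (s * (A + ln (n%:R / sigma_min)) / n%:R))
                          (delta_app / sigma_star) in
  eta <= eps ^+ 2 / 6 ->
  eps <= Num.sqrt 2 * delta_star ->
  (* outer probability of the event {d_H(phat, p_* ) > eps} *)
  exists E : set Omega, measurable E /\
    [set w | hellinger (pdens Z PZ (fhat w) (sigmahat w)) (pdens Z PZ fstar sigma_star) > eps]
      `<=` E /\
    (P E <= (5 * expR (- C1 * n%:R * eps ^+ 2) + C2 / n%:R)%:E)%E.
Proof.
(* What remains of the rate [1 / 12] of a far bracket after [1 / 24] is spent on the bracket width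
   and [1 / 48] on the number of brackets. *)
exists 48^-1; split; first by rewrite invr_gt0.
move=> D D0; exists 0, 1; split=> // K smax _ smax0.
have D1 : 1 <= D%:R :> R by rewrite ler1n.
(* The first summand pays for the number of brackets, the second for their width and for the
   approximation error. Since [C3 >= 1], these linear requirements pass to [C3 ^+ 2]. *)
pose C3 : R := 48 * (4 + smax) + 72 * D%:R.
have C3_1 : 1 <= C3 by rewrite /C3; lra.
have C30 : 0 < C3 by exact: lt_le_trans C3_1.
exists C3; split=> //.
move=> n d Z PZ smin F s A fstar sstar dapp eta dO Omega P X fhat shat.
move=> n0 _ oZ PZ1 smin0 _ smin1 mF _ s1 A1 cov mfstar /andP[sstarl sstaru] _.
move=> [f0 [Ff0 f0star]] mX indep lawX Fhat mle eps etale _.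
have mZ := open_tuple_set_measurable oZ.
have nR : 0 < n%:R :> R by rewrite ltr0n.
have sstar0 : 0 < sstar by exact: lt_le_trans sstarl.
have f0d := supdist_le f0star.
(* A distance at an actual point and coordinate is needed: mass one makes [Z] nonempty, and [D] is
   positive. *)
have dapp0 : 0 <= dapp.
  have [Z0|/set0P[z Zz]] := eqVneq Z set0.
    by move: PZ1; rewrite Z0 measure0 => -[] /eqP; rewrite eq_sym oner_eq0.
  by rewrite (le_trans _ (f0d z (Ordinal D0) Zz)).
have rho0 : 0 < n%:R^-1 :> R by rewrite invr_gt0.
(* Half of the radius [smin / n] that the brackets tolerate, since moving centers into [F] doubles
   it. *)
pose delc := smin * n%:R^-1 / 2.
have delc0 : 0 < delc by rewrite !mulr_gt0.
have Fne : exists f, F f by exists f0.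
have [N [c [NB Fc covc]]] := covering_centers Fne (cov delc delc0).
pose G := (Num.truncn (smax / (smin * n%:R^-1))).+1.
have [NG B1] := bracketing_number_le n0 smin0 smin1 smax0 s1 A1 NB.
pose B := s * (A + ln (n%:R / smin)).
have eps0 : 0 <= eps.
  by rewrite mulr_ge0 ?(ltW C30)// le_max sqrtr_ge0.
have epsB : C3 ^+ 2 * B <= n%:R * eps ^+ 2.
  have : C3 * Num.sqrt (B / n%:R) <= eps by rewrite ler_pM2l// le_max lexx.
  move=> h; have h2 : (C3 * Num.sqrt (B / n%:R)) ^+ 2 <= eps ^+ 2.
    by rewrite lerXn2r// nnegrE mulr_ge0 ?sqrtr_ge0 ?(ltW C30).
  rewrite -ler_pdivrMl// (le_trans _ h2)// exprMn sqr_sqrtr; last first.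
    by rewrite divr_ge0 ?(ltW nR)// (le_trans ler01).
  by rewrite mulrCA (mulrC _^-1).
have epsd : C3 ^+ 2 * (dapp / sstar) ^+ 2 <= eps ^+ 2.
  have h : C3 * (dapp / sstar) <= eps by rewrite ler_pM2l// le_max lexx orbT.
  have h0 : 0 <= C3 * (dapp / sstar).
    by rewrite mulr_ge0 ?divr_ge0// ?(ltW C30) ?(ltW sstar0).
  by rewrite -exprMn; apply: lerXn2r; rewrite ?nnegrE.
have C3sq : C3 <= C3 ^+ 2 by rewrite expr2 ler_peMr// ltW.
pose Y := n%:R * eps ^+ 2.
have Y0 : 0 <= Y by rewrite mulr_ge0 ?(ltW nR)// sqr_ge0.
have YkB : 48 * ((4 + smax) * B) <= Y.
  apply: le_trans epsB; rewrite mulrA ler_wpM2r ?(le_trans ler01)//.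
  by rewrite (le_trans _ C3sq)// /C3; lra.
have YD : 72 * D%:R <= Y.
  apply: (le_trans _ epsB); apply: (@le_trans _ _ (C3 ^+ 2 * 1)).
    by rewrite mulr1 (le_trans _ C3sq)// /C3; lra.
  by rewrite ler_wpM2l// sqr_ge0.
have epsD : 72 * (D%:R * (dapp / sstar) ^+ 2) <= eps ^+ 2.
  apply: le_trans epsd; rewrite mulrA ler_wpM2r ?sqr_ge0//.
  by rewrite (le_trans _ C3sq)// /C3; lra.
pose I : finType := ('I_N * 'I_G)%type.
pose sgrid (k : 'I_G) := (1 + n%:R^-1) ^+ 2 * (smin * (1 + n%:R^-1 * k%:R)) : R.
have sgrid0 k : 0 < sgrid k.
  have k0 : 0 < 1 + n%:R^-1 * k%:R :> R.
    by apply: (lt_le_trans ltr01); rewrite lerDl mulr_ge0// ltW.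
  apply: mulr_gt0; last exact: mulr_gt0.
  by rewrite exprn_gt0// addr_gt0.
pose q (i : I) := pdens Z PZ (c i.1) (sgrid i.2).
have dens f t : F f -> 0 < t -> density (pdens Z PZ f t).
  by move=> Ff t0; apply: density_pdens => //; exact: mF.
have shat0 w : 0 < shat w by have [_ /andP[h _]] := Fhat w; exact: lt_le_trans h.
have brk w : exists i : I, forall x,
    pdens Z PZ (fhat w) (shat w) x <= expR (3 * n%:R^-1 * D%:R) * q i x.
  have [Fw sw] := Fhat w.
  have [i Hi] := covc _ Fw.
  have [k Hk] := scale_grid rho0 smin0 sw.
  exists (i, k) => x; apply: (pdens_bracket mZ PZ1 x rho0 smin0 _ Hk).
  - by case/andP : sw.
  - exact: mF.
  - exact: mF.
  - move=> z j Zz; apply: (le_trans (Hi z j Zz)).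
    by rewrite /delc le_eqVlt; apply/orP; left; apply/eqP; field; rewrite gt_eqF.
have sstarI : smin <= sstar <= smax by rewrite sstarl sstaru.
have n1 : 1 <= n%:R :> R by rewrite ler1n.
have etale' : eta <= n%:R * (eps ^+ 2 / 6).
  by rewrite (le_trans etale)// ler_peMl// divr_ge0// sqr_ge0.
(* The approximant [f0] is taken at the true scale [sstar], so its likelihood ratio involves only
   the shift of the means. *)
have [E [mE subE PE]] := approximate_mle_deviation mX indep
  (density_pdens mZ PZ1 sstar0 mfstar) lawX
  (fun i : I => dens _ _ (Fc i.1) (sgrid0 i.2)) (dens _ _ Ff0 sstar0)
  (fun w => dens _ _ (Fhat w).1 (shat0 w)) eps0
  (integral_likelihood_ratio_le mZ PZ1 sstar0 mfstar (mF _ Ff0) f0d) brk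
  (fun w => mle w f0 sstar Ff0 sstarI) etale'.
exists E; split=> //; split=> //.
apply: (le_trans PE); rewrite lee_fin mul0r addr0.
have e1 : #|I|%:R * expR (n%:R * (3 * n%:R^-1 * D%:R - eps ^+ 2 / 12))
    <= expR (- 48^-1 * n%:R * eps ^+ 2).
  rewrite card_prod !card_ord natrM.
  apply: (le_trans (ler_wpM2r (expR_ge0 _) NG)).
  rewrite -expRD ler_expR -/B.
  rewrite (_ : - 48^-1 * n%:R * eps ^+ 2 = - (Y / 48)); last by rewrite /Y; field.
  rewrite (_ : n%:R * (_ - _) = 3 * D%:R - Y / 12); first by lra.
  by rewrite /Y; field; rewrite gt_eqF.
(* By [epsD] the approximation error costs at most [eps ^+ 2 / 72] of the available
   [eps ^+ 2 / 6]. *)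
have e2 : expR (n%:R * (D%:R * (dapp / sstar) ^+ 2 - eps ^+ 2 / 6))
    <= expR (- 48^-1 * n%:R * eps ^+ 2).
  rewrite ler_expR (_ : - 48^-1 * n%:R * eps ^+ 2 = n%:R * (- (eps ^+ 2 / 48))).
    by rewrite ler_pM2l//; have := sqr_ge0 eps; lra.
  by field.
have := expR_ge0 (- 48^-1 * n%:R * eps ^+ 2); lra.
Qed.
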